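(* Let $\mathbb{K}$ be a commutative ring, let $P$ be a regular path complex with vertex set $V$ and let $\widehat{P}$ be its completion. Then there is an isomorphism of chain complexes $$\Omega P\cong\Omega(\mathcal{S}(\widehat{P})),$$ where $\Omega P$ is the complex of $\partial$-invariant paths of $P$ and $\Omega(\mathcal{S}(\widehat P))$ is the complex of the path pair of sets $\mathcal{S}(\widehat{P})=(\mathsf{cosk}_0(V),\widehat{P})$.
   Context: For a non-negatively graded chain complex $C$ of $\mathbb{K}$-modules with differential $\partial$ and a graded submodule $D\subseteq C$ (not necessarily a subcomplex), $\omega(C,D)$ is the subcomplex with $\omega(C,D)_n=D_n\cap\partial^{-1}(D_{n-1})$. For a simplicial module $A$, $\mathsf{C}A$ is the complex with components $A_n$ and differential $\sum_i(-1)^id_i$, $\mathsf{D}A$ its degenerate subcomplex $\mathsf{D}_nA=\sum_is_i(A_{n-1})$, $\mathsf{N}A$ the Moore complex $\mathsf{N}_nA=\bigcap_{i\ne0}\ker(d_i)$, and $\rho:\mathsf{C}A=\mathsf{N}A\oplus\mathsf{D}A\to\mathsf{N}A$ the projection; $\rho$ induces $\mathsf{C}A/\mathsf{D}A\cong\mathsf{N}A$, and these are identified. A path pair of sets is $(X,Y)$ where $X$ is a simplicial set and $Y=(Y_n\subseteq X_n)_{n\ge0}$ is a sequence of subsets closed under all degeneracies and the exterior faces $d_0,d_n:X_n\to X_{n-1}$. With $A=\mathbb{K}[X]$ (levelwise free module), $B=\mathbb{K}[Y]$, $\overline{B}_n=\rho(B_n)$, its complex is $\Omega(X,Y)=\omega(\mathsf{N}A,\overline{B})$.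 For a set $V$, $\mathsf{cosk}_0(V)$ is the simplicial set with $\mathsf{cosk}_0(V)_n=V^{n+1}$, $d_i$ deleting the $i$-th entry and $s_i$ repeating the $i$-th entry. Put $\Lambda(V)=\mathbb{K}[\mathsf{cosk}_0(V)]$ and $\mathcal{R}(V)=\mathsf{N}(\Lambda(V))=\mathsf{C}(\Lambda(V))/\mathsf{D}(\Lambda(V))$. A path complex is $P=(V,(P_n)_{n\ge0})$ with $V$ a set and $P_n\subseteq V^{n+1}$ such that $(v_0,\dots,v_n)\in P_n$ (with $n\geq 1$) implies $(v_0,\dots,v_{n-1}),(v_1,\dots,v_n)\in P_{n-1}$. It is regular if every $(v_0,\dots,v_n)\in P_n$ satisfies $v_i\ne v_{i+1}$ for all $i$. For a regular path complex, $\mathcal{A}_n(P)\subseteq\mathcal{R}_n(V)$ is the submodule generated by the images of the elements of $P_n$, and $\Omega P=\omega(\mathcal{R}(V),\mathcal{A}(P))$. A path complex is complete if $(v_0,\dots,v_n)\in P_n$ implies $(v_0,\dots,v_i,v_i,\dots,v_n)\in P_{n+1}$ for all $i$; equivalently $(P_n)$ is a sequence of subsets of $\mathsf{cosk}_0(V)$ closed under degeneracies and exterior faces. The completion $\widehat{P}$ of $P$ is the minimal complete path complex on the vertex set $V$ containing $P$. *)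

(* Defs.v *)
From HB Require Import structures.
From mathcomp Require Import all_boot all_order all_algebra zify.
From mathcomp Require Import finmap monalg boolp.

Set Implicit Arguments.
Unset Strict Implicit.
Unset Printing Implicit Defensive.

Import GRing.Theory.
Local Open Scope ring_scope.

Record submod (K : pzRingType) (M : lmodType K) := Submod {
  in_submod :> M -> Prop;
  submod0 : in_submod 0;
  submodP : forall a u v,
    in_submod u -> in_submod v -> in_submod (a *: u + v) }.

Section SubmodTheory.
Variables (K : pzRingType) (M : lmodType K) (S : submod M).

Definition submod_pred : {pred M} := fun x => `[< S x >].

Fact submod_pred_closed : submod_closed submod_pred.
Proof.
split=> [|a u v /asboolP Su /asboolP Sv]; apply/asboolP; first exact: submod0.
exact: submodP.
Qed.

HB.instance Definition _ :=
  GRing.isSubmodClosed.Build K M submod_pred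
    (GRing.submod_closed_semi submod_pred_closed).

Definition submod_type := {x : M | x \in submod_pred}.
HB.instance Definition _ := SubChoice.on submod_type.
HB.instance Definition _ := [SubChoice_isSubLmodule of submod_type by <:].

Lemma submod_valP (x : submod_type) : S (val x).
Proof. exact/asboolP/(valP x). Qed.

Definition submod_mk (x : M) (Sx : S x) : submod_type :=
  exist _ x (asboolT Sx).

Lemma submodZ a u : S u -> S (a *: u).
Proof. by move=> Su; rewrite -[a *: u]addr0; apply/submodP/submod0. Qed.
Lemma submodD u v : S u -> S v -> S (u + v).
Proof. by move=> Su Sv; rewrite -[u]scale1r; apply: submodP. Qed.
Lemma submodB u v : S u -> S v -> S (u - v).
Proof.
by move=> Su Sv; apply: submodD => //; rewrite -scaleN1r; apply: submodZ.
Qed.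
Lemma submod_sum (I : Type) (r : seq I) (F : I -> M) :
  (forall i, S (F i)) -> S (\sum_(i <- r) F i).
Proof.
move=> SF; elim/big_rec: _ => [|i x _]; [exact: submod0|exact: submodD].
Qed.
End SubmodTheory.

(* The smallest submodule containing G. *)
Section Span.
Variables (K : pzRingType) (M : lmodType K) (G : M -> Prop).

Definition in_span (x : M) : Prop :=
  forall S : submod M, (forall g, G g -> S g) -> S x.

Fact in_span0 : in_span 0. Proof. by move=> S _; apply: submod0. Qed.
Fact in_spanP a u v : in_span u -> in_span v -> in_span (a *: u + v).
Proof. by move=> Gu Gv S GS; apply: submodP; [apply: Gu|apply: Gv]. Qed.

Definition span : submod M := Submod in_span0 in_spanP.
End Span.

Section Image.
Variables (K : pzRingType) (M N : lmodType K) (f : {linear M -> N}).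
Variable S : submod M.

Definition in_image (y : N) : Prop := exists2 x, S x & y = f x.

Fact in_image0 : in_image 0.
Proof. by exists 0; [apply: submod0|rewrite linear0]. Qed.
Fact in_imageP a u v : in_image u -> in_image v -> in_image (a *: u + v).
Proof.
by case=> x Sx -> [y Sy ->]; exists (a *: x + y); [apply: submodP|rewrite linearP].
Qed.

Definition submod_image : submod N := Submod in_image0 in_imageP.
End Image.

(* Non-negatively graded; the differential leaving degree 0 is zero and is left
   implicit. *)
Record chain_complex (K : pzRingType) := ChainComplex {
  ch_obj :> nat -> lmodType K;
  ch_d : forall n, {linear ch_obj n.+1 -> ch_obj n};
  ch_dd : forall n (x : ch_obj n.+2), ch_d n (ch_d n.+1 x) = 0 }.

Definition chain_isomorphic (K : pzRingType) (C D : chain_complex K) : Prop :=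
  exists f : forall n, {linear C n -> D n},
    (forall n (x : C n.+1), ch_d D n (f n.+1 x) = f n (ch_d C n x)) /\
    (forall n, bijective (f n)).

Section Subcomplex.
Variables (K : pzRingType) (C : chain_complex K) (D : forall n, submod (C n)).
Hypothesis Dd : forall n x, D n.+1 x -> D n (ch_d C n x).

Definition sub_d n (x : submod_type (D n.+1)) : submod_type (D n) :=
  submod_mk (Dd (submod_valP x)).

Fact sub_d_linear n : linear (@sub_d n).
Proof. by move=> a u v; apply: val_inj; rewrite /= linearP. Qed.

HB.instance Definition _ n :=
  GRing.isLinear.Build K (submod_type (D n.+1)) (submod_type (D n)) _
    (@sub_d n) (@sub_d_linear n).

Fact sub_dd n (x : submod_type (D n.+2)) : sub_d (sub_d x) = 0.
Proof. by apply: val_inj; rewrite /= ch_dd. Qed.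

Definition subcomplex : chain_complex K :=
  @ChainComplex K (fun n => submod_type (D n))
    (fun n => @sub_d n : {linear _ -> _}) sub_dd.
End Subcomplex.

(* In degree 0 the condition involving D_(-1) = 0 is vacuous. *)
Section Omega.
Variables (K : pzRingType) (C : chain_complex K) (D : forall n, submod (C n)).

Definition in_omega n : C n -> Prop :=
  match n with
  | 0 => fun x => D 0 x
  | m.+1 => fun x => D m.+1 x /\ D m (ch_d C m x)
  end.

Fact in_omega0 n : in_omega (0 : C n).
Proof. by case: n => [|n] /=; rewrite ?linear0; do ?split; apply: submod0. Qed.
Fact in_omegaP n a (u v : C n) :
  in_omega u -> in_omega v -> in_omega (a *: u + v).
Proof.
case: n u v => [|n] u v /=; first exact: submodP.
by case=> ? ? [? ?]; rewrite linearP; split; apply: submodP.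
Qed.

Definition omega_submod n : submod (C n) := Submod (@in_omega0 n) (@in_omegaP n).

Fact omega_submod_d n (x : C n.+1) :
  omega_submod n.+1 x -> omega_submod n (ch_d C n x).
Proof.
by case: n x => [|n] x /= [Dx Ddx] //; split=> //; rewrite ch_dd; apply: submod0.
Qed.

Definition omega : chain_complex K := subcomplex omega_submod_d.
End Omega.

(* The indices of faces and degeneracies are ordinals; in the identities they are
   natural numbers, in the range where inord is faithful. *)
Record simplicial_identities (X : nat -> Type)
    (d : forall n, 'I_n.+2 -> X n.+1 -> X n)
    (s : forall n, 'I_n.+1 -> X n -> X n.+1) : Prop := SimplicialIdentities {
  simpl_dd : forall n i j (x : X n.+2), (i < j <= n.+2)%N ->
    d n (inord i) (d n.+1 (inord j) x) = d n (inord j.-1) (d n.+1 (inord i) x);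
  simpl_ds_lt : forall n i j (x : X n.+1), (i < j <= n.+1)%N ->
    d n.+1 (inord i) (s n.+1 (inord j) x) = s n (inord j.-1) (d n (inord i) x);
  simpl_ds_id : forall n i (x : X n), (i <= n)%N ->
    d n (inord i) (s n (inord i) x) = x;
  simpl_ds_idS : forall n i (x : X n), (i <= n)%N ->
    d n (inord i.+1) (s n (inord i) x) = x;
  simpl_ds_gt : forall n i j (x : X n.+1), (j.+1 < i <= n.+2)%N ->
    d n.+1 (inord i) (s n.+1 (inord j) x) = s n (inord j) (d n (inord i.-1) x);
  simpl_ss : forall n i j (x : X n), (i <= j <= n)%N ->
    s n.+1 (inord i) (s n (inord j) x) = s n.+1 (inord j.+1) (s n (inord i) x) }.

Record sset := SSet {
  ss_obj :> nat -> choiceType;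
  ss_d : forall n, 'I_n.+2 -> ss_obj n.+1 -> ss_obj n;
  ss_s : forall n, 'I_n.+1 -> ss_obj n -> ss_obj n.+1;
  ss_ax : simplicial_identities ss_d ss_s }.

Record smod (K : pzRingType) := SMod {
  sm_obj :> nat -> lmodType K;
  sm_d : forall n, 'I_n.+2 -> {linear sm_obj n.+1 -> sm_obj n};
  sm_s : forall n, 'I_n.+1 -> {linear sm_obj n -> sm_obj n.+1};
  sm_ax : simplicial_identities sm_d sm_s }.

(* The alias gives {malg K[X]} a module structure over a possibly trivial ring K;
   monalg only provides one over nontrivial rings. *)
Definition freemod (K : pzRingType) (X : choiceType) := {malg K[X]}.

Section FreeModule.
Variables (K : pzRingType) (X : choiceType).

HB.instance Definition _ := GRing.Zmodule.on (freemod K X).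

Definition free_scale (c : K) (g : freemod K X) : freemod K X :=
  [malg x in msupp g => c * g@_x].

Fact free_scaleE c g x : (free_scale c g)@_x = c * g@_x.
Proof. by rewrite mcoeffE; case: msuppP; rewrite ?mulr0. Qed.
Fact free_scaleA a b g : free_scale a (free_scale b g) = free_scale (a * b) g.
Proof. by apply/malgP=> x; rewrite !free_scaleE mulrA. Qed.
Fact free_scale1 : left_id 1 free_scale.
Proof. by move=> g; apply/malgP=> x; rewrite free_scaleE mul1r. Qed.
Fact free_scaleDr : right_distributive free_scale +%R.
Proof.
by move=> c g h; apply/malgP=> x; rewrite mcoeffD !free_scaleE mcoeffD mulrDr.
Qed.
Fact free_scaleDl g : {morph free_scale^~ g : a b / a + b}.
Proof.
by move=> a b; apply/malgP=> x; rewrite mcoeffD !free_scaleE mulrDl.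
Qed.

HB.instance Definition _ := GRing.Zmodule_isLmodule.Build K (freemod K X)
  free_scaleA free_scale1 free_scaleDr free_scaleDl.

Definition fbasis (x : X) : freemod K X := << 1 *g x >>.

Lemma mcoeff_freeP a (u v : freemod K X) x : (a *: u + v)@_x = a * u@_x + v@_x.
Proof. by rewrite mcoeffD free_scaleE. Qed.

Lemma fbasisZ c x : c *: fbasis x = << c *g x >>.
Proof.
apply/malgP=> y; rewrite free_scaleE !mcoeffU.
by case: eqP; rewrite ?mulr1 ?mulr0.
Qed.

Lemma free_ind (S : submod (freemod K X)) :
  (forall x, S (fbasis x)) -> forall g, S g.
Proof.
move=> Sb g; rewrite [g]monalgE; apply: submod_sum => x.
by rewrite -fbasisZ; apply: submodZ.
Qed.
End FreeModule.

Section FreeMap.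
Variables (K : pzRingType) (X Y : choiceType) (f : X -> Y).

Definition free_map (g : freemod K X) : freemod K Y :=
  \sum_(x <- msupp g) g@_x *: fbasis K (f x).

Lemma free_mapEw (E : {fset X}) g : (msupp g `<=` E)%fset ->
  free_map g = \sum_(x <- E) g@_x *: fbasis K (f x).
Proof.
move=> le; rewrite [LHS](big_fset_incl _ le) => //= x xd /mcoeff_outdom ->.
by rewrite scale0r.
Qed.

Fact free_map_linear : linear free_map.
Proof.
move=> a u v; set E := (msupp (a *: u + v)%R `|` (msupp u `|` msupp v))%fset.
have E1 : (msupp (a *: u + v)%R `<=` E)%fset by apply: fsubsetUl.
have E2 : (msupp u `<=` E)%fset by apply/fsubsetP => x xu; rewrite !inE xu orbT.
have E3 : (msupp v `<=` E)%fset by apply/fsubsetP => x xv; rewrite !inE xv !orbT.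
rewrite (free_mapEw E1) (free_mapEw E2) (free_mapEw E3).
rewrite scaler_sumr -big_split /=; apply: eq_bigr => x _.
by rewrite mcoeff_freeP scalerDl scalerA.
Qed.

HB.instance Definition _ := GRing.isLinear.Build K (freemod K X) (freemod K Y)
  _ free_map free_map_linear.

Lemma free_map_basis x : free_map (fbasis K x) = fbasis K (f x).
Proof.
by rewrite (free_mapEw msuppU_le) big_seq_fset1 mcoeffUU scale1r.
Qed.
End FreeMap.

Section FreeExt.
Variables (K : pzRingType) (X : choiceType).

Lemma free_ext (M : lmodType K) (f g : {linear freemod K X -> M}) :
  (forall x, f (fbasis K x) = g (fbasis K x)) -> f =1 g.
Proof.
move=> fg u.
have S0 : f 0 = g 0 by rewrite !linear0.
have SP a x y : f x = g x -> f y = g y -> f (a *: x + y) = g (a *: x + y).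
  by rewrite !linearP => -> ->.
exact: (@free_ind K X (Submod S0 SP)).
Qed.

Lemma free_map_id_ext (f : X -> X) : f =1 id -> @free_map K _ _ f =1 id.
Proof.
move=> fE; apply: (@free_ext _ (@free_map K _ _ f) idfun) => x.
by rewrite /= free_map_basis fE.
Qed.

Lemma free_map_comp_ext (Y Z : choiceType) (g : Y -> Z) (f : X -> Y) (h : X -> Z) :
  g \o f =1 h -> @free_map K _ _ g \o @free_map K _ _ f =1 @free_map K _ _ h.
Proof.
move=> gf; apply: (@free_ext _ (@free_map K _ _ g \o @free_map K _ _ f)) => x.
by rewrite /= !free_map_basis -gf.
Qed.
End FreeExt.

Section FreeSimplicial.
Variables (K : pzRingType) (X : sset).

Let fd n i : {linear freemod K (X n.+1) -> freemod K (X n)} :=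
  @free_map K _ _ (@ss_d X n i).
Let fs n i : {linear freemod K (X n) -> freemod K (X n.+1)} :=
  @free_map K _ _ (@ss_s X n i).

Fact free_simplicial :
  @simplicial_identities (fun n => freemod K (X n)) fd fs.
Proof.
have H := ss_ax X.
have com (A B B' C : choiceType) (f : A -> B) (g : B -> C) (f' : A -> B')
    (g' : B' -> C) : (forall x, g (f x) = g' (f' x)) ->
    forall x : freemod K A, free_map g (free_map f x) = free_map g' (free_map f' x).
  move=> E x; rewrite -[LHS]/((_ \o _) x) -[RHS]/((_ \o _) x).
  rewrite (@free_map_comp_ext K A B C g f (g \o f)) //.
  by rewrite (@free_map_comp_ext K A B' C g' f' (g \o f)) // => y; rewrite /= E.
have idm (A B : choiceType) (f : A -> B) (g : B -> A) : (forall x, g (f x) = x) ->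
    forall x : freemod K A, free_map g (free_map f x) = x.
  move=> E x; rewrite -[LHS]/((_ \o _) x) (@free_map_comp_ext K A B A g f (g \o f)) //.
  exact: free_map_id_ext.
split=> n i => [j x ij|j x ij|x ij|x ij|j x ij|j x ij].
- by apply: com => y; exact: (simpl_dd H).
- by apply: com => y; exact: (simpl_ds_lt H).
- by apply: idm => y; exact: (simpl_ds_id H).
- by apply: idm => y; exact: (simpl_ds_idS H).
- by apply: com => y; exact: (simpl_ds_gt H).
- by apply: com => y; exact: (simpl_ss H).
Qed.

Definition free_smod : smod K :=
  @SMod K (fun n => freemod K (X n)) fd fs free_simplicial.
End FreeSimplicial.

Lemma alternating_sum0 (K : pzRingType) (M : lmodType K) (m : nat)
    (f : nat -> nat -> M) :
  (forall i j, (i < j <= m)%N -> f i j = f j.-1 i) ->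
  \sum_(i < m) \sum_(j < m.+1) (-1) ^+ (i + j) *: f i j = 0.
Proof.
move=> H.
pose g (i j : nat) := (-1) ^+ (i + j) *: f i j.
have E (i : 'I_m) : \sum_(j < m.+1) (-1) ^+ (i + j) *: f i j =
    \sum_(j < m | (j <= i)%N) g i j - \sum_(j < m | (i <= j)%N) g j i.
  rewrite (bigID (fun j : 'I_m.+1 => (j <= i)%N)) /=; congr (_ + _).
    by rewrite big_mkcond big_ord_recr /= leqNgt ltn_ord addr0 -big_mkcond.
  rewrite big_mkcond big_ord_recl /= add0r -sumrN [RHS]big_mkcond /=.
  apply: eq_bigr => j _; rewrite /bump /= add1n -ltnNge ltnS.
  case: leqP => // ij; rewrite /g H; last by rewrite ltnS ij ltn_ord.
  by rewrite addnS exprS mulN1r scaleNr addnC.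
under eq_bigr do rewrite E.
rewrite big_split /= sumrN.
by rewrite (exchange_big_dep xpredT) //= subrr.
Qed.

Section SimplicialModule.
Variables (K : pzRingType) (A : smod K).

Local Notation d := (@sm_d K A _).
Local Notation s := (@sm_s K A _).

Definition alt_face n (x : A n.+1) : A n :=
  \sum_(i < n.+2) (-1) ^+ i *: d i x.

Fact alt_face_linear n : linear (@alt_face n).
Proof.
move=> a u v; rewrite /alt_face scaler_sumr -big_split /=.
apply: eq_bigr => i _; rewrite linearP scalerDr !scalerA.
by congr (_ *: _ + _); rewrite -signr_odd; case: odd;
  rewrite ?mul1r ?mulr1 // mulN1r mulrN1.
Qed.

HB.instance Definition _ n :=
  GRing.isLinear.Build K (A n.+1) (A n) _ (@alt_face n) (@alt_face_linear n).

Fact alt_face_alt_face n (x : A n.+2) : alt_face (alt_face x) = 0.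
Proof.
rewrite -[RHS](@alternating_sum0 K (A n) n.+2
  (fun i j => d (inord i) (d (inord j) x))) => [|i j ij]; last first.
  exact: simpl_dd (sm_ax A) _ _ _ _ ij.
rewrite {1}/alt_face; apply: eq_bigr => i _.
rewrite /alt_face linear_sum scaler_sumr; apply: eq_bigr => j _.
by rewrite linearZ scalerA -exprD !inord_val.
Qed.

Definition assoc_complex : chain_complex K :=
  @ChainComplex K A (fun n => @alt_face n : {linear _ -> _}) alt_face_alt_face.

Definition in_degenerate n : A n -> Prop :=
  match n with
  | 0 => fun x => x = 0
  | m.+1 => fun x => exists y : 'I_m.+1 -> A m, x = \sum_i s i (y i)
  end.

Fact in_degenerate0 n : in_degenerate (0 : A n).
Proof.
case: n => [|n] //=; exists (fun=> 0).
by rewrite big1 // => i _; rewrite linear0.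
Qed.
Fact in_degenerateP n a (u v : A n) :
  in_degenerate u -> in_degenerate v -> in_degenerate (a *: u + v).
Proof.
case: n u v => [|n] u v /=; first by move=> -> ->; rewrite scaler0 addr0.
case=> y -> [z ->]; exists (fun i => a *: y i + z i).
rewrite scaler_sumr -big_split; apply: eq_bigr => i _ /=.
by rewrite linearP.
Qed.

Definition degenerate n : submod (A n) :=
  Submod (@in_degenerate0 n) (@in_degenerateP n).

Definition in_moore n : A n -> Prop :=
  match n with
  | 0 => fun=> True
  | m.+1 => fun x => forall i : 'I_m.+2, i != ord0 -> d i x = 0
  end.

Fact in_moore0 n : in_moore (0 : A n).
Proof. by case: n => [|n] //= i _; rewrite linear0. Qed.
Fact in_mooreP n a (u v : A n) :
  in_moore u -> in_moore v -> in_moore (a *: u + v).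
Proof.
case: n u v => [|n] u v //= Nu Nv i i0.
by rewrite linearP /= Nu // Nv // scaler0 addr0.
Qed.

Definition moore n : submod (A n) := Submod (@in_moore0 n) (@in_mooreP n).

Lemma in_moore_inord n (x : A n.+1) i :
  in_moore x -> (0 < i <= n.+1)%N -> d (inord i) x = 0.
Proof.
by move=> Nx i0; apply: Nx; rewrite -val_eqE /= inordK //; lia.
Qed.

Fact moore_closed n (x : assoc_complex n.+1) :
  moore n.+1 x -> moore n (ch_d assoc_complex n x).
Proof.
case: n x => [|n] x // Nx j j0.
rewrite /= /alt_face big_ord_recl big1 => [|i _]; last first.
  by rewrite Nx // scaler0.
rewrite expr0 scale1r addr0 -[j]inord_val.
have j1 : (0 < j)%N by rewrite lt0n.
have jn : (0 < j.+1 <= n.+2)%N by exact: ltn_ord j.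
have /= E := simpl_dd (sm_ax A) x jn.
have i0 : inord 0 = ord0 :> 'I_n.+3 by apply: val_inj; rewrite /= inordK.
by rewrite -i0 -E (in_moore_inord Nx jn) linear0.
Qed.

Definition moore_complex : chain_complex K := subcomplex moore_closed.

(* CA = NA (+) DA, which rho_fun relies on: T k is the endomorphism
   1 - s_k d_(k+1), and Q t = T (m - t + 1) o ... o T (m - 1) o T m. *)

Let T m k (x : A m.+1) : A m.+1 := x - s (inord k) (d (inord k.+1) x).

Let degenerate_s m k (w : A m) : degenerate m.+1 (s (inord k) w).
Proof.
exists (fun j => if j == inord k then w else 0).
rewrite (bigD1 (inord k)) //= eqxx big1 ?addr0 // => i /negbTE ->.
by rewrite linear0.
Qed.

Let T_id m k (x : A m.+1) : (k <= m)%N -> d (inord k.+1) (T k x) = 0.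
Proof.
by move=> km; rewrite /T linearB /= (simpl_ds_idS (sm_ax A)) // subrr.
Qed.

Let T_gt m k i (x : A m.+1) : (k.+1 < i <= m.+1)%N ->
  d (inord i) x = 0 -> d (inord i) (T k x) = 0.
Proof.
case: m x => [|m] x ki dx; first lia.
rewrite /T linearB /= dx (simpl_ds_gt (sm_ax A)) ; last lia.
rewrite -(simpl_dd (sm_ax A)); last lia.
by rewrite dx !linear0 addr0.
Qed.

Let T_s m k i (z : A m) : (i < k <= m)%N ->
  exists z', T k (s (inord i) z) = s (inord i) z'.
Proof.
case: m z => [|m] z ik; first lia.
rewrite /T; exists (z - s (inord k.-1) (d (inord k) z)).
rewrite (simpl_ds_gt (sm_ax A)) /=; last lia.
have ikm : (i <= k.-1 <= m)%N by lia.
by rewrite linearB /= (simpl_ss (sm_ax A) _ ikm) prednK //; lia.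
Qed.

Let T_s0 m k (z : A m) : (k <= m)%N -> T k (s (inord k) z) = 0.
Proof. by move=> km; rewrite /T (simpl_ds_idS (sm_ax A)) // subrr. Qed.

Let TD m k (x y : A m.+1) : T k (x + y) = T k x + T k y.
Proof. by rewrite /T !linearD addrACA. Qed.

Let T0 m k : T k (0 : A m.+1) = 0.
Proof. by rewrite /T !linear0 addr0. Qed.

Let Q m t (x : A m.+1) : A m.+1 :=
  iteri t (fun r y => T (m - r) y) x.

Let Q_sum m t (I : Type) (r : seq I) (F : I -> A m.+1) :
  Q t (\sum_(i <- r) F i) = \sum_(i <- r) Q t (F i).
Proof.
elim: t => [|t IH] //; rewrite /Q /= -/(Q t _) IH.
by rewrite (big_morph _ (TD (m - t)) (T0 m (m - t))).
Qed.

Let Q_moore m t (x : A m.+1) : moore m.+1 x -> (t <= m.+1)%N -> Q t x = x.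
Proof.
move=> Nx; elim: t => [|t IH] // tm; rewrite /Q /= -/(Q t _) IH; last lia.
have mt : (0 < (m - t).+1 <= m.+1)%N by lia.
by rewrite /T (in_moore_inord Nx mt) linear0 subr0.
Qed.

Let Q_s m t i (z : A m) : (i + t <= m)%N ->
  exists z', Q t (s (inord i) z) = s (inord i) z'.
Proof.
elim: t => [|t IH] itm; first by exists z.
have [|z' Qz] := IH; first lia.
by rewrite /Q /= -/(Q t _) Qz; apply: T_s; lia.
Qed.

Let Q_s0 m t i (z : A m) : (i <= m)%N -> (m < i + t)%N ->
  Q t (s (inord i) z) = 0.
Proof.
elim: t => [|t IH] im itm; first lia.
rewrite /Q /= -/(Q t _).
have [itm'|itm'] := leqP (i + t) m; last by rewrite IH // T0.
have [z' ->] := Q_s z itm'.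
by have -> : (m - t = i)%N by [lia]; rewrite T_s0.
Qed.

Lemma moore_degenerate_eq0 n (x : A n) : moore n x -> degenerate n x -> x = 0.
Proof.
case: n x => [|m] x Nx // [y xE].
rewrite -(Q_moore Nx (leqnn _)) xE Q_sum big1 // => i _.
rewrite -[i in s i]inord_val Q_s0 //; first by rewrite -ltnS.
by rewrite addnS ltnS leq_addl.
Qed.

Lemma moore_degenerate_decomp n (x : A n) :
  exists y : submod_type (moore n), degenerate n (x - val y).
Proof.
case: n x => [|m] x.
  exists (@submod_mk _ _ (moore 0) x I) => /=; exact: subrr.
have QN t : (t <= m.+1)%N ->
    forall i, (m.+1 - t < i <= m.+1)%N -> d (inord i) (Q t x) = 0.
  elim: t => [|t IH] tm i im; first lia.
  rewrite /Q /= -/(Q t _).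
  have [ile|igt] := leqP i (m - t).+1; last first.
    by apply: T_gt; [lia|apply: IH; lia].
  by have -> : i = (m - t).+1 by [lia]; apply: T_id; lia.
have QD t : degenerate m.+1 (x - Q t x).
  elim: t => [|t IH]; first by rewrite subrr; apply: submod0.
  have -> : Q t.+1 x = T (m - t) (Q t x) by [].
  by rewrite /T opprB addrCA; apply: submodD => //; apply: degenerate_s.
have Nx : moore m.+1 (Q m.+1 x).
  move=> i i0; rewrite -[i]inord_val; apply: QN => //.
  have := ltn_ord i; have : (0 < i)%N by rewrite lt0n.
  lia.
by exists (submod_mk Nx); apply: QD.
Qed.

(* The component in NA of x in NA (+) DA. *)
Definition rho_fun n (x : assoc_complex n) : moore_complex n :=
  projT1 (cid (moore_degenerate_decomp x)).

Lemma rho_funP n (x : assoc_complex n) : degenerate n (x - val (rho_fun x)).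
Proof. exact: (projT2 (cid (moore_degenerate_decomp x))). Qed.

Lemma rho_fun_unique n (x : assoc_complex n) (y : moore_complex n) :
  degenerate n (x - val y) -> rho_fun x = y.
Proof.
move=> Dy; apply: val_inj; apply/eqP; rewrite -subr_eq0; apply/eqP.
apply: moore_degenerate_eq0; first by apply: submodB; apply: submod_valP.
have -> : val (rho_fun x) - val y = (x - val y) - (x - val (rho_fun x)).
  by rewrite opprB [RHS]addrC subrKA.
by apply: submodB => //; apply: rho_funP.
Qed.

Fact rho_linear n : linear (@rho_fun n).
Proof.
move=> a u v; apply: rho_fun_unique.
have -> : a *: u + v - val (a *: rho_fun u + rho_fun v : moore_complex n) =
    a *: (u - val (rho_fun u)) + (v - val (rho_fun v)).
  by rewrite /= scalerBr opprD addrACA.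
by apply: submodP; apply: rho_funP.
Qed.

HB.instance Definition _ n := GRing.isLinear.Build K
  (assoc_complex n) (moore_complex n) _ (@rho_fun n) (@rho_linear n).

Definition rho n : {linear assoc_complex n -> moore_complex n} := @rho_fun n.
End SimplicialModule.

Record path_pair := PathPair {
  pp_X : sset;
  pp_Y : forall n, pp_X n -> Prop;
  pp_s : forall n (i : 'I_n.+1) x, pp_Y x -> pp_Y (ss_s i x);
  pp_d0 : forall n (x : pp_X n.+1), pp_Y x -> pp_Y (ss_d ord0 x);
  pp_dn : forall n (x : pp_X n.+1), pp_Y x -> pp_Y (ss_d ord_max x) }.

Section PathPairComplex.
Variables (K : comPzRingType) (Z : path_pair).

(* K[Y_n] as a submodule of K[X_n]. *)
Definition pair_submod n : submod (freemod K (pp_X Z n)) :=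
  span (fun b => exists2 x, pp_Y x & b = fbasis K x).

Definition pair_complex : chain_complex K :=
  omega (fun n => submod_image (rho (free_smod K (pp_X Z)) n) (pair_submod n)).
End PathPairComplex.

(* A tuple (v_0, ..., v_n) is the function i |-> v_i in V ^ n.+1, which is
   {ffun 'I_n.+1 -> V}. *)
Section Cosk0.
Variable V : choiceType.

Definition cosk0_d n (i : 'I_n.+2) (v : V ^ n.+2) : V ^ n.+1 :=
  [ffun j => v (lift i j)].

(* unbump i is the monotone surjection taking the value i exactly at i, i.+1. *)
Definition cosk0_s n (i : 'I_n.+1) (v : V ^ n.+1) : V ^ n.+2 :=
  [ffun j : 'I_n.+2 => v (inord (unbump i j))].

Fact cosk0_simplicial :
  @simplicial_identities (fun n => (V ^ n.+1)%type) cosk0_d cosk0_s.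
Proof.
have ub n (i j : nat) : (i <= n)%N -> (j <= n.+1)%N -> (unbump i j < n.+1)%N.
  by rewrite /unbump; lia.
have lt n (i : 'I_n) : (i < n)%N := ltn_ord i.
split=> n i => [j x ij|j x ij|x ij|x ij|j x ij|j x ij]; apply/ffunP => k;
  rewrite !ffunE ?ffunE; have kn := lt _ k;
  try (rewrite -[RHS](congr1 x (inord_val k))); congr (x _); apply: val_inj;
  rewrite /= ?inordK /bump /unbump ?inordK /bump /unbump //=; lia.
Qed.

Definition cosk0 : sset :=
  @SSet (fun n => (V ^ n.+1)%type) cosk0_d cosk0_s cosk0_simplicial.
End Cosk0.

Record path_complex (V : choiceType) := PathComplex {
  pc_mem :> forall n, cosk0 V n -> Prop;
  pc_init : forall n (v : cosk0 V n.+1), pc_mem v -> pc_mem (cosk0_d ord_max v);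
  pc_tail : forall n (v : cosk0 V n.+1), pc_mem v -> pc_mem (cosk0_d ord0 v) }.

Section PathComplex.
Variable V : choiceType.
Implicit Types P Q : path_complex V.

Definition regular P : Prop :=
  forall n (v : V ^ n.+1), P n v ->
  forall i : 'I_n, v (widen_ord (leqnSn n) i) != v (lift ord0 i).

Definition complete P : Prop :=
  forall n (v : V ^ n.+1) (i : 'I_n.+1), P n v -> P n.+1 (cosk0_s i v).

Section Completion.
Variable P : path_complex V.

Definition in_completion n (v : cosk0 V n) : Prop :=
  forall Q, complete Q -> (forall m (w : cosk0 V m), P m w -> Q m w) -> Q n v.

Fact in_completion_init n (v : cosk0 V n.+1) :
  in_completion v -> in_completion (n := n) (cosk0_d ord_max v).
Proof. by move=> Pv Q cQ PQ; apply/pc_init/Pv. Qed.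
Fact in_completion_tail n (v : cosk0 V n.+1) :
  in_completion v -> in_completion (n := n) (cosk0_d ord0 v).
Proof. by move=> Pv Q cQ PQ; apply/pc_tail/Pv. Qed.

Definition completion : path_complex V :=
  PathComplex in_completion_init in_completion_tail.

Lemma completion_complete : complete completion.
Proof. by move=> n v i Pv Q cQ PQ; apply/cQ/Pv. Qed.
End Completion.

Definition complete_pair P (cP : complete P) : path_pair :=
  @PathPair (cosk0 V) P (fun n i v => @cP n v i) (@pc_tail V P) (@pc_init V P).

Section PathComplexComplex.
Variables (K : comPzRingType) (P : path_complex V).

Definition regular_paths : chain_complex K :=
  moore_complex (free_smod K (cosk0 V)).

Definition allowed_paths n : submod (regular_paths n) :=
  span (fun a => exists2 v : cosk0 V n,
    P n v & a = rho (free_smod K (cosk0 V)) n (fbasis K v)).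

Definition path_omega : chain_complex K := omega allowed_paths.
End PathComplexComplex.
End PathComplex.

(* Main.v *)
Require Import Defs.
From mathcomp Require Import all_boot all_algebra.
From mathcomp Require Import zify boolp.

(* Both complexes are omega of submodules of the same complex R(V). An element
   of the completion that is not in P is a degeneracy of another one, so its
   basis vector is killed by rho; hence the two families of submodules agree. *)

Set Implicit Arguments.
Unset Strict Implicit.
Unset Printing Implicit Defensive.

Import GRing.Theory.
Local Open Scope ring_scope.

(** Equality, not mere equivalence, lets one family of submodules be rewritten into another inside
    [omega]. *)
Lemma submod_ext (K : pzRingType) (M : lmodType K) (S T : submod M) :
  (forall x, S x <-> T x) -> S = T.
Proof.
case: S T => [S S0 SP] [T T0 TP] /= ST.
have E : S = T by apply/funext => x; apply/propext.
by case: _ / E T0 TP => T0 TP; congr Submod; apply: Prop_irrelevance.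
Qed.

Lemma chain_isomorphic_refl (K : pzRingType) (C : chain_complex K) :
  chain_isomorphic C C.
Proof.
exists (fun n => (idfun : {linear C n -> C n})).
by split=> // n; exists idfun.
Qed.

Lemma mem_span (K : pzRingType) (M : lmodType K) (G : M -> Prop) x :
  G x -> Defs.span G x.
Proof. by move=> Gx S; apply. Qed.

Lemma span_sub (K : pzRingType) (M : lmodType K) (G : M -> Prop) (S : submod M) :
  (forall x, G x -> S x) -> forall x, Defs.span G x -> S x.
Proof. by move=> GS x; apply. Qed.

(** The preimage of [S] under [f] is a submodule containing [G], hence its span. *)
Lemma submod_image_span (K : pzRingType) (M N : lmodType K)
    (f : {linear M -> N}) (G : M -> Prop) (S : submod N) :
  (forall x, G x -> S (f x)) -> forall y, submod_image f (Defs.span G) y -> S y.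
Proof.
move=> GS _ [x Gx ->].
have S0 : S (f 0) by rewrite linear0; apply: submod0.
have SP a u v : S (f u) -> S (f v) -> S (f (a *: u + v)).
  by rewrite linearP; apply: submodP.
exact: (@span_sub _ _ G (Submod S0 SP)).
Qed.

(** A degeneracy differs from 0 by a degenerate element, so its Moore component is 0 by
    uniqueness. *)
Lemma rho_s (K : pzRingType) (A : smod K) n (i : 'I_n.+1) (x : A n) :
  rho A n.+1 (sm_s A i x) = 0.
Proof.
apply: rho_fun_unique => /=; rewrite subr0.
exists (fun j => if j == i then x else 0).
by rewrite (bigD1 i) //= eqxx big1 ?addr0 // => j /negbTE ->; rewrite linear0.
Qed.

Section Completion.
Variables (V : choiceType) (P : path_complex V).

(** A complete path complex above [P] built from below: unlike the intersection defining
    [completion], it allows case analysis on its elements. *)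
Inductive degeneracy_closure : forall n, cosk0 V n -> Prop :=
| closure_base n (v : cosk0 V n) : P n v -> degeneracy_closure v
| closure_s n (i : 'I_n.+1) (v : cosk0 V n) :
    degeneracy_closure v -> degeneracy_closure (n := n.+1) (cosk0_s i v).

(** Induction on the closure, with $d_0s_0=1$ and $d_0s_i=s_{i-1}d_0$ for $i>0$. *)
Lemma closure_tail n (v : cosk0 V n.+1) :
  degeneracy_closure v -> degeneracy_closure (n := n) (cosk0_d ord0 v).
Proof.
(* The induction ranges over all degrees, so the claim is made trivially true in degree 0. *)
pose T m : cosk0 V m -> Prop :=
  if m is m'.+1 then fun v => degeneracy_closure (n := m') (cosk0_d ord0 v)
  else fun=> True.
suff H m (w : cosk0 V m) : degeneracy_closure w -> T m w by apply: H.
elim=> {m w} [[|m] w Pw //|m i w Qw].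
  exact/closure_base/pc_tail.
have SI := cosk0_simplicial V.
have zeroE k : ord0 = inord 0 :> 'I_k.+1 by apply: val_inj; rewrite /= inordK.
move=> Tw /=; rewrite zeroE -[i]inord_val; case: (posnP i) => [->|i0].
  by rewrite (simpl_ds_id SI).
case: m i i0 w Qw Tw => [|m] i i0 w Qw Tw; first by case: i i0 => [[]].
rewrite (simpl_ds_lt SI); last by rewrite i0 -ltnS /=.
by apply: closure_s; rewrite -zeroE.
Qed.

(** Mirror image: $d_{m+1}s_m=1$, and $d_{m+1}s_i=s_id_m$ for $i<m$. *)
Lemma closure_init n (v : cosk0 V n.+1) :
  degeneracy_closure v -> degeneracy_closure (n := n) (cosk0_d ord_max v).
Proof.
pose T m : cosk0 V m -> Prop :=
  if m is m'.+1 then fun v => degeneracy_closure (n := m') (cosk0_d ord_max v)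
  else fun=> True.
suff H m (w : cosk0 V m) : degeneracy_closure w -> T m w by apply: H.
elim=> {m w} [[|m] w Pw //|m i w Qw].
  exact/closure_base/pc_init.
have SI := cosk0_simplicial V.
have maxE k : ord_max = inord k :> 'I_k.+1 by apply: val_inj; rewrite /= inordK.
move=> Tw /=; rewrite maxE -[i]inord_val.
have im : (i <= m)%N by rewrite -ltnS.
case: (ltngtP i m) => [lim|lt|->]; [|lia|by rewrite (simpl_ds_idS SI)].
case: m i w Qw Tw im lim => [|m] i w Qw Tw im lim; first lia.
rewrite (simpl_ds_gt SI) /=; last lia.
by apply: closure_s; rewrite -maxE.
Qed.

Definition closure_complex : path_complex V :=
  PathComplex closure_init closure_tail.

(** Minimality of the completion, tested against [closure_complex]. *)
Lemma completion_cases n (v : cosk0 V n) : completion P n v ->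
  P n v \/ exists m (i : 'I_m.+1) (w : cosk0 V m) (e : m.+1 = n),
    v = ecast k (cosk0 V k) e (cosk0_s i w).
Proof.
move=> Pv; have : closure_complex n v.
  by apply: Pv => [m w i|m w]; [exact: closure_s|exact: closure_base].
case=> {n v Pv} [n v Pv|n i v _]; first by left.
by right; exists n, i, v, (erefl _).
Qed.

Lemma rho_completion (K : pzRingType) n (v : cosk0 V n) : completion P n v ->
  P n v \/ rho (free_smod K (cosk0 V)) n (fbasis K v) = 0.
Proof.
case/completion_cases=> [|[m [i [w [e]]]]]; first by left.
case: n / e v => v -> /=; right.
(* The basis vector of a degeneracy is the degeneracy of a basis vector. *)
by rewrite -free_map_basis; apply: (@rho_s _ (free_smod K (cosk0 V))).
Qed.

Lemma allowed_paths_completion (K : comPzRingType) n :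
  allowed_paths K P n =
  submod_image (rho (free_smod K (cosk0 V)) n)
    (pair_submod K (complete_pair (completion_complete (P := P))) n).
Proof.
apply: submod_ext => x; split.
  apply: span_sub => _ [v Pv ->]; exists (fbasis K v) => //.
  by apply: mem_span; exists v => // Q _; apply.
apply: submod_image_span => _ [v Pv ->].
(* A generator outside [P] maps to 0. *)
have [Pv'|->] := rho_completion K Pv; last exact: submod0.
by apply: mem_span; exists v.
Qed.

End Completion.

Theorem proposition9p6 (K : comPzRingType) (V : choiceType)
    (P : path_complex V) (regP : regular P) :
  chain_isomorphic (path_omega K P)
    (pair_complex K (complete_pair (completion_complete (P := P)))).
Proof.
(* The two complexes become the same term, so the identity is the isomorphism. *)
rewrite /path_omega (functional_extensionality_dep (allowed_paths_completion P K)).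
exact: chain_isomorphic_refl.
Qed.
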